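(* Let $n \ge 4$ be a positive integer and let $\alpha = \lfloor \log_2 n \rfloor$. Among all finite groups of order $\le n$, the elementary abelian group of order $2^\alpha$ has the highest number of composition series. That is, for every finite group $G$ with $|G| \le n$, \[ |\mathcal{C}_G| \le \prod_{i=1}^{\lfloor \log_2 n \rfloor} (2^i - 1), \] and equality holds if and only if $G$ is (isomorphic to) the elementary abelian $2$-group $(\mathbb{Z}/2\mathbb{Z})^\alpha$ of order $2^\alpha$.
   Context: For a finite group $G$, $\mathcal{C}_G$ denotes the set of all distinct composition series of $G$, i.e. chains of subgroups $\{e\} = G_0 \trianglelefteq G_1 \trianglelefteq \dots \trianglelefteq G_\ell = G$ with each $G_i/G_{i-1}$ simple; two composition series are distinct if they differ as chains of subgroups of $G$ (not merely up to isomorphism). *)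

(* Defs.v *)
From mathcomp Require Import all_boot all_algebra all_fingroup all_solvable.

Set Implicit Arguments.
Unset Strict Implicit.
Unset Printing Implicit Defensive.

(* [comps G s] says that G > s_1 > ... > s_l = 1 is a composition series of G,
   each term being a maximal proper normal subgroup of the previous one; the
   head G is left out of s, so distinct s are distinct chains.  This is the
   same as having normal inclusions with simple quotients. *)
Lemma comps_simpleE (gT : finGroupType) (G : {group gT}) (s : seq {group gT}) :
  comps G s =
    (last G s == 1%G)
    && path [rel H K : {group gT} | (K <| H)%g && simple (H / K)%g] G s.
Proof.
congr (_ && _); apply: eq_path => H K /=.
have [nKH | nnKH] := boolP (K <| H)%g; first by rewrite quotient_simple.
by apply: contraNF nnKH; apply: maxnormal_normal.
Qed.

(* Sequences of subgroups form an infinite type; bounding their size by #|G|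
   makes them a finite one without losing any series. *)
Lemma comps_size (gT : finGroupType) (G : {group gT}) (s : seq {group gT}) :
  comps G s -> size s < #|G|.
Proof.
elim: s G => [|H s IHs] G csG /=; first exact: cardG_gt0.
have ltHG : #|H| < #|G|.
  by case/compsP: csG => _ /= /andP[/maxnormal_proper/proper_card].
exact: leq_ltn_trans (IHs _ (comps_cons csG)) ltHG.
Qed.

Definition comp_series (gT : finGroupType) (G : {group gT}) :
    {set #|G|.-bseq {group gT}} :=
  [set s : #|G|.-bseq {group gT} | comps G s].

Lemma comp_seriesP (gT : finGroupType) (G : {group gT}) (s : seq {group gT}) :
  reflect (exists2 t, t \in comp_series G & s = t :> seq _) (comps G s).
Proof.
apply: (iffP idP) => [csG | [t]]; last by rewrite inE => ? ->.
by exists (Bseq (ltnW (comps_size csG))); rewrite ?inE.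
Qed.

(* Main.v *)
Require Import Defs.
From mathcomp Require Import all_boot all_algebra all_fingroup all_solvable.
From mathcomp Require Import zify mxabelem.

Set Implicit Arguments.
Unset Strict Implicit.
Unset Printing Implicit Defensive.

(**
Let c(G) be the number of composition series of G, and let 2 ^ m <= |G| <
2 ^ (m + 1). Then c(G) is the sum of c(H) over the maximal normal subgroups H
of G; each such H has order at most |G| / 2, so that by induction it is enough
to show that there are at most 2 ^ m - 1 of them.

Fix a maximal normal N of index r. Then H |-> H :&: N sends the other maximal
normal subgroups to maximal normal subgroups of N and preserves the index. Two
subgroups in the same fiber have index r, and a fiber has at most r elements
since these are disjoint outside N. Inductively, if A of the maximal normal
subgroups have index 2 and B have a larger index, then A < 2 ^ a and
2 ^ a (2 B + 1) <= |G| for some a. Hence A + B <= 2 ^ m - 1, and equality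
forces either B = 0, or |G| = 2 ^ (m + 1) - 1. In the first case the
intersection R of the maximal normal subgroups is trivial, because the bound
holds with |G : R| instead of |G|, and so G has exponent 2. In the second case
equality also holds for every H, hence H has order 2 ^ (m - 1) if m > 2, but
|G| is odd; for m = 2, G has order 7 and is simple.

Conversely, in an elementary abelian 2-group the kernels of nonzero linear
forms already provide 2 ^ m - 1 maximal subgroups.
*)

(** * Recursion on the first term of a composition series *)

Lemma card_comp_series1 (gT : finGroupType) :
  #|comp_series (1%G : {group gT})| = 1.
Proof.
have <-: #|[set [bseq] : #|(1%G : {group gT})|.-bseq {group gT}]| = 1.
  by rewrite cards1.
apply: eq_card => s; rewrite !inE.
apply/idP/eqP => [cs | ->]; last by rewrite /comps /= eqxx.
by apply/val_inj/eqP; rewrite /= -(trivg_comps cs).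
Qed.

Definition maxns (gT : finGroupType) (G : {group gT}) : {set {group gT}} :=
  [set H : {group gT} | maxnormal H G G].

Lemma card_comp_series_rec (gT : finGroupType) (G : {group gT}) :
  (G :!=: 1)%g ->
  #|comp_series G| = \sum_(H in maxns G) #|comp_series H|.
Proof.
move=> ntG.
(* The type of [comp_series K] depends on [#|K|]; forgetting the size bound puts the series of [G]
   and of its subgroups in one type. *)
pose L (K : {group gT}) := [seq val s | s <- enum (comp_series K)].
have sizeL K : size (L K) = #|comp_series K| by rewrite size_map -cardE.
have uniqL K : uniq (L K) by rewrite (map_inj_uniq val_inj) enum_uniq.
have memL K s : (s \in L K) = comps K s.
  apply/mapP/comp_seriesP => -[t]; first by rewrite mem_enum; exists t.
  by move=> tK ->; exists t; rewrite ?mem_enum.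
pose M := [seq H : {group gT} <- enum {: {group gT}} | maxnormal H G G].
have perm_LG : perm_eq (L G) [seq H :: s | H <- M, s <- L H].
  apply: uniq_perm => //.
    apply: allpairs_uniq_dep => [|H _|[H s] [K t] _ _ /= [-> ->]] //.
    by rewrite filter_uniq ?enum_uniq.
  move=> s; rewrite memL; apply/idP/allpairsPdep => [cs | [H [t [MH tH ->]]]].
    case: s cs => [|H s] cs; first by rewrite (trivg_comps cs) in ntG.
    exists H, s; rewrite memL (comps_cons cs) mem_filter mem_enum andbT.
    by case/compsP: cs => _ /= /andP[].
  move: MH tH; rewrite mem_filter memL => /andP[maxH _] /compsP[lt pt].
  by apply/compsP; rewrite /= maxH lt.
rewrite -sizeL (perm_size perm_LG) size_allpairs_dep sumnE big_map big_filter.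
rewrite big_enum_cond /=.
by apply: eq_big => [H | H _]; rewrite ?inE ?sizeL.
Qed.

(** * Intersections of maximal normal subgroups *)

Lemma maxnormalI (gT : finGroupType) (G N H : {group gT}) :
    maxnormal N G G -> maxnormal H G G -> N != H ->
  maxnormal (H :&: N)%g N N /\ #|N : H :&: N|%g = #|G : H|%g.
Proof.
move=> maxN maxH neNH.
have nsHG := maxnormal_normal maxH; have sNG := maxnormal_sub maxN.
have nHN : N \subset 'N(H)%g := subset_trans sNG (normal_norm nsHG).
have defG : (N * H)%g = G by apply: maxnormalM => // /eqP; apply/negP.
have iso : (N / (H :&: N))%g \isog (G / H)%g by rewrite -defG weak_second_isog.
split; last first.
  by rewrite -!card_quotient ?normsI ?normG ?(normal_norm nsHG) ?(card_isog iso).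
have nsHN : ((H :&: N)%G <| N)%g by rewrite /normal subsetIr normsI ?normG.
by rewrite -(quotient_simple nsHN) (isog_simple iso) quotient_simple.
Qed.

(** Distinct [H1], [H2] in [T] meet exactly in [K]: both [H1 :&: N = K] and [H1 :&: H2] are maximal
    normal in [H1], and the first lies in the second. With r = [#|G : N|], the sets [H :\: N] are
    thus disjoint of size (r - 1) |K|, inside [G :\: N] of size (r - 1) r |K|. *)
Lemma card_maxnormalI_fiber (gT : finGroupType) (G N K : {group gT})
    (T : {set {group gT}}) :
    maxnormal N G G ->
    (forall H, H \in T -> [/\ maxnormal H G G, N != H & H :&: N = K]) ->
    1 < #|T| ->
  (forall H, H \in T -> #|G : H|%g = #|G : N|%g) /\ #|T| <= #|G : N|%g.
Proof.
move=> maxN defT gt1T; have sNG := maxnormal_sub maxN.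
have TI H1 H2 : H1 \in T -> H2 \in T -> H1 != H2 ->
    H2 :&: H1 = K /\ #|G : H2|%g = #|G : N|%g.
  move=> /defT[max1 ne1 def1] /defT[max2 _ def2] ne12.
  have [max21 i21] := maxnormalI max1 max2 ne12.
  have ne1N : H1 != N by rewrite eq_sym.
  have [maxN1 iN1] := maxnormalI max1 maxN ne1N.
  have eqI : H2 :&: H1 = K.
    have sub : H1 :&: N \subset H1 :&: H2.
      by rewrite subsetI subsetIl def1 -def2 subsetIl.
    rewrite setIC -def1; move: maxN1 max21; rewrite ![_ :&: H1]setIC.
    by move=> /maxgroupP[_ maxN1] /maxgroupp /maxN1; apply.
  by split=> //; rewrite -i21 -iN1 eqI setIC def1.
have idx H : H \in T -> #|G : H|%g = #|G : N|%g.
  move=> TH; have /card_gt0P[H1] : 0 < #|T :\ H|.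
    by move: gt1T; rewrite (cardsD1 H T) TH.
  by rewrite !inE => /andP[neH TH1]; have [] := TI H1 H TH1 TH neH.
split=> //.
have gt1r : 1 < #|G : N|%g.
  by rewrite indexg_gt1; case/andP: (maxnormal_proper maxN).
have oT H : H \in T ->
    #|H :\: N| = (#|G : N|%g).-1 * #|K| /\ #|N| = #|G : N|%g * #|K|.
  move=> TH; have [maxH neH defK] := defT _ TH.
  have neHN : H != N by rewrite eq_sym.
  have [_ i1] := maxnormalI maxN maxH neH.
  have [_ i2] := maxnormalI maxH maxN neHN.
  have:= Lagrange (subsetIr H N); have:= Lagrange (subsetIl H N).
  rewrite /= setIC in i2.
  rewrite /= cardsD; rewrite defK in i1 i2 *; rewrite i1 i2 idx //.
  move=> <- <-; split; last by rewrite mulnC.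
  by rewrite -{2}[#|K|]muln1 -mulnBr subn1 mulnC.
have ltDN : \sum_(H in T) #|H :\: N| <= #|G :\: N|.
  under eq_bigr do rewrite -sum1_card.
  rewrite (exchange_big_dep (mem (G :\: N))) /= => [|H x TH]; last first.
    rewrite !inE => /andP[-> Hx]; have [maxH _ _] := defT _ TH.
    exact: subsetP (maxnormal_sub maxH) x Hx.
  rewrite -sum1_card; apply: leq_sum => x /setDP[_ nNx].
  rewrite sum1dep_card; apply/card_le1_eqP => H1 H2.
  rewrite !inE => /andP[TH1 /andP[_ x1]] /andP[TH2 /andP[_ x2]].
  apply/eqP; apply: contraT; rewrite eq_sym => ne12.
  have [defK _] := TI H1 H2 TH1 TH2 ne12.
  have [_ _ /setP/(_ x)] := defT _ TH1.
  by rewrite -defK !inE x1 x2 (negPf nNx).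
have /card_gt0P[H TH] : 0 < #|T| by apply: ltnW.
have [_ oN] := oT H TH.
have := Lagrange sNG; have := cardG_gt0 K.
move: ltDN; rewrite (eq_bigr (fun=> (#|G : N|%g).-1 * #|K|)) => [|H1 /oT[]//].
rewrite sum_nat_const cardsD (setIidPr sNG) oN => lt0 K0 oG.
rewrite -oG in lt0.
have p0 : 0 < (#|G : N|%g).-1 * #|K|.
  by rewrite muln_gt0 K0 andbT -ltnS prednK // ltnW.
rewrite -(leq_pmul2r p0); apply: leq_trans lt0 _.
set r := #|_ : _|%g; set k := #|K|.
by rewrite -{2}[r * k]muln1 -mulnBr subn1 -mulnA [k * _]mulnC.
Qed.

(** * Counting maximal normal subgroups by index *)

Definition maxn_over (gT : finGroupType) (R G : {group gT}) (P : pred nat) :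
    {set {group gT}} :=
  [set H : {group gT} | [&& maxnormal H G G, R \subset H & P #|G : H|%g]].

Lemma card_maxn_over_fiber (gT : finGroupType) (R G N K : {group gT}) P
    (T := [set H in maxn_over R G P | (H != N) && ((H :&: N)%G == K)]) :
    maxnormal N G G ->
  #|T| <= if P #|G : N|%g then #|G : N|%g else 1.
Proof.
move=> maxN.
have defT H : H \in T -> [/\ maxnormal H G G, N != H & H :&: N = K].
  rewrite !inE => /andP[/and3P[maxH _ _] /andP[neH /eqP <-]].
  by rewrite eq_sym.
have [le1 | gt1] := leqP #|T| 1.
  by case: ifP => // _; apply: leq_trans le1 (indexg_gt0 _ _).
have [idx leT] := card_maxnormalI_fiber maxN defT gt1.
have /card_gt0P[H TH] : 0 < #|T| by apply: ltnW.
by have := TH; rewrite !inE => /andP[/and3P[_ _]]; rewrite idx // => ->.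
Qed.

(** The successor accounts for [N] itself; all other members are sorted by their intersection with
    [N]. *)
Lemma card_maxn_over (gT : finGroupType) (R G N : {group gT}) P :
    maxnormal N G G -> R \subset N ->
  #|maxn_over R G P| <=
    if P #|G : N|%g then (#|G : N|%g * #|maxn_over R N P|).+1
    else #|maxn_over R N P|.
Proof.
move=> maxN sRN.
have le0 : #|maxn_over R G P :\ N| <=
    (if P #|G : N|%g then #|G : N|%g else 1) * #|maxn_over R N P|.
  rewrite -sum1_card.
  rewrite (partition_big (fun H => (H :&: N)%G) (mem (maxn_over R N P))) /=.
    rewrite mulnC -sum_nat_const; apply: leq_sum => K _; rewrite sum1dep_card.
    apply: leq_trans (card_maxn_over_fiber R K P maxN).
    apply/subset_leq_card/subsetP => H.
    by rewrite !inE => /andP[/andP[-> ->] ->].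
  move=> H; rewrite !inE => /and4P[neHN maxH sRH PH].
  have neNH : N != H by rewrite eq_sym.
  by have [-> ->] := maxnormalI maxN maxH neNH; rewrite PH subsetI sRH sRN.
rewrite (cardsD1 N) inE maxN sRN /=; by case: ifP le0 => _; rewrite ?mul1n.
Qed.

(** Here a counts the steps of index 2 in a descending chain of maximal normal subgroups containing
    [R]. Such a step turns A into at most 2 A + 1 and keeps the bound on B; a step of index r > 2
    keeps that on A and turns B into at most r B + 1, where 2 (r B + 1) + 1 <= r (2 B + 1) because r
    >= 3. *)
Lemma card_maxn_over_bound (gT : finGroupType) (R G : {group gT}) :
    R \subset G ->
  exists a, [/\ #|maxn_over R G (eq_op^~ 2)| < 2 ^ a &
    2 ^ a * (#|maxn_over R G (predC1 2)|.*2.+1) * #|R| <= #|G|].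
Proof.
have [n] := ubnP #|G|; elim: n G => // n IHn G /ltnSE-leGn sRG.
have [N /andP[maxN sRN] | noN] :=
  pickP [pred N : {group gT} | maxnormal N G G && (R \subset N)]; last first.
  have M0 P : #|maxn_over R G P| = 0.
    apply: eq_card0 => H; rewrite inE; apply/and3P => -[maxH sRH _].
    by have := noN H; rewrite /= maxH sRH.
  by exists 0; rewrite !M0 mul1n subset_leq_card.
have ltNG := proper_card (maxnormal_proper maxN).
have [a [h2 hG]] := IHn N (leq_trans ltNG leGn) sRN.
have gt1r : 1 < #|G : N|%g.
  by rewrite indexg_gt1; case/andP: (maxnormal_proper maxN).
have := card_maxn_over (eq_op^~ 2) maxN sRN.
have := card_maxn_over (predC1 2) maxN sRN.
rewrite /= -(Lagrange (maxnormal_sub maxN)).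
case: eqVneq gt1r => [-> _ | ne2 gt1r] /= leB leA.
  exists a.+1; rewrite expnS; split.
    by apply: leq_ltn_trans leA _; rewrite !mul2n -doubleS leq_double.
  rewrite -!mulnA mulnC leq_pmul2r // mulnA.
  by apply: leq_trans hG; rewrite leq_mul2r leq_mul2l ltnS leq_double leB !orbT.
have arith r b c :
  1 < r -> r != 2 -> b <= (r * c).+1 -> b.*2.+1 <= r * c.*2.+1 by nia.
exists a; split; first exact: leq_ltn_trans leA h2.
set B := #|maxn_over R N _| in hG leB.
apply: (@leq_trans (2 ^ a * (#|G : N|%g * B.*2.+1) * #|R|)).
  by rewrite leq_mul2r leq_mul2l (arith _ _ _ gt1r ne2 leB) !orbT.
by rewrite mulnCA -mulnA mulnC leq_mul2r hG orbT.
Qed.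

(** * The bound on the number of maximal normal subgroups *)

Lemma abelem2_maxnsI (gT : finGroupType) (G : {group gT}) :
    (forall H, H \in maxns G -> #|G : H|%g = 2) ->
    (G :&: \bigcap_(H in maxns G) H \subset [1 gT])%g ->
  (2.-abelem G)%g.
Proof.
move=> idx2 R1; apply: exponent2_abelem; apply/exponentP => x Gx.
apply/set1gP; apply: (subsetP R1); rewrite inE groupX //=.
apply/bigcapP => H MH.
have := MH; rewrite inE => /maxnormal_normal nsHG.
have Nx := subsetP (normal_norm nsHG) x Gx.
apply: coset_idr; first exact: groupX.
rewrite morphX //; apply/eqP; rewrite -order_dvdn -(idx2 H MH).
rewrite -card_quotient ?normal_norm //.
by apply: order_dvdG; apply: mem_quotient.
Qed.

(** The point is 2 (A + B) + 1 <= g: since A <= q - 1, the difference q (2 B + 1) - (2 A + 2 B + 1)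
    is at least (q - 1) (2 B - 1). *)
Lemma lt_add_of_mul_double A B q g M :
    0 < B -> A < q -> q * B.*2.+1 <= g -> g < 2 * M ->
  A + B < M /\ ((A + B).+1 = M -> g.+1 = 2 * M).
Proof.
case: B q => [|b] [|q] // _.
have ->: q.+1 * b.+1.*2.+1 = (q * b).*2 + 3 * q + 2 * b + 3 by nia.
lia.
Qed.

Lemma card_maxns (gT : finGroupType) (G : {group gT}) (m := trunc_log 2 #|G|) :
  #|maxns G| < 2 ^ m /\
  (#|maxns G|.+1 = 2 ^ m -> ((2.-abelem G)%g /\ #|G| = 2 ^ m) \/
     #|G|.+1 = 2 ^ m.+1).
Proof.
pose R := (G :&: \bigcap_(H in maxns G) H)%G.
have [a [h2 hG]] := card_maxn_over_bound (subsetIl G _ : R \subset G).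
have /andP[le_m lt_m] := trunc_log_bounds (isT : 1 < 2) (cardG_gt0 G).
rewrite -/m in le_m lt_m.
have maxn_overR P :
    maxn_over R G P = maxns G :&: [set H : {group gT} | P #|G : H|%g].
  apply/setP => H; rewrite !inE; apply: andb_id2l => maxH.
  by rewrite [_ \subset _]subIset ?bigcap_inf ?inE ?orbT.
have := cardsID [set H : {group gT} | #|G : H|%g == 2] (maxns G).
rewrite -(maxn_overR (eq_op^~ 2)).
have -> : maxns G :\: [set H : {group gT} | #|G : H|%g == 2]
    = maxn_over R G (predC1 2).
  by rewrite maxn_overR; apply/setP => H; rewrite !inE andbC.
have := cardG_gt0 R; move: h2 hG.
set A := maxn_over R G _; set B := maxn_over R G _.
have [B0 | B_gt0] := posnP #|B|.
  rewrite B0 addn0 muln1 => h2 hG R_gt0 <-.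
  have le_am : a <= m.
    rewrite -ltnS -(ltn_exp2l _ _ (isT : 1 < 2)); apply: leq_ltn_trans lt_m.
    by apply: leq_trans hG; apply: leq_pmulr.
  split=> [|eqA]; first by apply: leq_trans h2 _; rewrite leq_exp2l.
  rewrite eqA leq_exp2l // in h2.
  have eq_am : a = m by apply/eqP; rewrite eqn_leq le_am.
  left; have R1 : R \subset [1 gT]%g.
    rewrite subG1 trivg_card1 eqn_leq R_gt0 andbT -ltnS.
    rewrite -(@ltn_pmul2l (2 ^ m)) ?expn_gt0 // -{1}eq_am.
    rewrite [X in _ < X]mulnC -expnS; exact: leq_ltn_trans lt_m.
  (* [R] is trivial since 2 ^ m |R| <= |G| < 2 ^ (m + 1), and every maximal normal subgroup has
     index 2 since [B] is empty. *)
  have abG : (2.-abelem G)%g.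
    apply: abelem2_maxnsI R1 => H MH; apply/eqP; apply: contraT => neH.
    have := card0_eq B0 H; rewrite /B maxn_overR inE MH inE /=.
    by rewrite (negPf neH).
  split=> //; have := card_pgroup (abelem_pgroup abG) => oG.
  rewrite oG leq_exp2l // ltn_exp2l // ltnS in le_m lt_m.
  by rewrite oG; congr (2 ^ _); apply/eqP; rewrite eqn_leq lt_m.
rewrite expnS in lt_m *.
move: (2 ^ a) (2 ^ m) le_m lt_m => q M le_m lt_m h2 hG R_gt0 <-.
have hG' : q * #|B|.*2.+1 <= #|G| by apply: leq_trans hG; apply: leq_pmulr.
have [lt eq] := lt_add_of_mul_double B_gt0 h2 hG' lt_m.
by split=> // /eq; right.
Qed.

(** * Hyperplanes of elementary abelian 2-groups *)

Lemma card_maxns_abelem2 (gT : finGroupType) (G : {group gT}) m :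
  (2.-abelem G)%g -> #|G| = 2 ^ m -> #|maxns G| = 2 ^ m - 1.
Proof.
move=> abG oG; apply/eqP; rewrite eqn_leq; apply/andP; split.
  by have [] := card_maxns G; rewrite oG trunc_expnK //; lia.
have : (G \isog [set: 'rV['F_2]_m])%g.
  rewrite (isog_abelem_card _ abG) mx_Fp_abelem //=.
  by rewrite cardsT card_mx card_Fp // mul1n oG.
case/isogP => f injf imf.
pose hyp (v : 'cV['F_2]_m) := [set x in G | f x *m v == 0]%R.
have hypP v : group_set (hyp v).
  apply/group_setP; split=> [|x y].
    by rewrite inE group1 morph1 mul0mx eqxx.
  rewrite !inE => /andP[Gx /eqP fx] /andP[Gy /eqP fy].
  by rewrite groupM // morphM // mulmxDl fx fy GRing.addr0 eqxx.
pose Hyp v := Group (hypP v).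
(* A scalar of F_2 is known once it is known whether it vanishes; hence a linear form is determined
   by its kernel. *)
have eq0_mx11 (a b : 'M['F_2]_1) : (a == 0)%R = (b == 0)%R -> a = b.
  have eq0E (c : 'M['F_2]_1) : (c == 0)%R = (c ord0 ord0 == 0)%R.
    apply/eqP/eqP => [-> | c0]; first by rewrite mxE.
    by apply/matrixP => i j; rewrite !ord1 c0 mxE.
  rewrite !eq0E => eqab; apply/matrixP => i j; rewrite !ord1; apply/eqP.
  by move: (a _ _) (b _ _) eqab => [[|[|?]] ?] [[|[|?]] ?].
have injH : injective Hyp.
  move=> v w eqH; apply/row_matrixP => i; apply: eq0_mx11; rewrite !rowE.
  have : delta_mx 0%R i \in (f @* G)%g by rewrite imf inE.
  case/morphimP => x Gx _ ->.
  by have /setP/(_ x) := congr1 (@gval gT) eqH; rewrite !inE Gx.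
have maxH v : v != 0%R -> Hyp v \in maxns G.
  move=> nzv; have sHG : Hyp v \subset G by apply/subsetP => x /[!inE] /andP[].
  rewrite inE; apply/maxgroupP; split=> [|K /andP[ltKG _] sHK].
    rewrite (sub_abelian_norm (abelem_abelian abG) sHG) properEneq sHG !andbT.
    apply: contra nzv => /eqP eqHG; apply/eqP/injH/val_inj.
    rewrite /= [LHS]eqHG.
    by apply/setP => x; rewrite !inE mulmx0 eqxx andbT.
  apply/eqP; rewrite eqEsubset sHK andbT; apply/subsetP => x Kx.
  case/properP: ltKG => sKG [y Gy notKy]; have Gx := subsetP sKG x Kx.
  (* If [x] in [K] lay outside the kernel, [y] would be in [K]: either [y] is in the kernel, or both
     forms take the value 1 and [x^-1 * y] is in the kernel. *)
  apply: contraR notKy => notHx; have [Hy | notHy] := boolP (y \in Hyp v).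
    exact: subsetP Hy.
  rewrite !inE Gx Gy /= in notHx notHy.
  have eq_xy : (f x *m v)%R = (f y *m v)%R.
    by apply: eq0_mx11; rewrite (negPf notHx) (negPf notHy).
  rewrite -(mulKVg x y) groupM // (subsetP sHK) // !inE groupM ?groupV //=.
  by rewrite morphM ?groupV // morphV // mulmxDl mulNmx eq_xy GRing.addNr.
have <- : #|[set~ 0%R : 'cV['F_2]_m]| = 2 ^ m - 1.
  by rewrite cardsC1 card_mx card_Fp // muln1 subn1.
rewrite -(card_imset _ injH); apply/subset_leq_card/subsetP.
move=> _ /imsetP[v nzv ->]; by apply: maxH; rewrite !inE in nzv.
Qed.

(** * The product bound and its equality case *)

(** This is the number of complete flags in an m-dimensional space over F_2. *)
Definition elem_series m := \prod_(1 <= i < m.+1) (2 ^ i - 1).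

Lemma elem_seriesS m : elem_series m.+1 = (2 ^ m.+1 - 1) * elem_series m.
Proof. by rewrite /elem_series big_nat_recr //= mulnC. Qed.

Lemma elem_series_gt0 m : 0 < elem_series m.
Proof.
elim: m => [|m IHm]; first by rewrite /elem_series big_geq.
by rewrite elem_seriesS muln_gt0 IHm subn_gt0 -{1}(expn0 2) ltn_exp2l.
Qed.

Lemma leq_elem_series : {homo elem_series : j k / j <= k}.
Proof.
apply: homo_leq => [m||m]; [exact: leqnn | exact: leq_trans |].
by rewrite elem_seriesS leq_pmull // subn_gt0 -{1}(expn0 2) ltn_exp2l.
Qed.

(** The product increases strictly only from index 1 on: its values at 0 and 1 are both 1, whence
    [1 < k]. *)
Lemma eq_elem_series j k :
  1 < k -> j <= k -> elem_series k <= elem_series j -> j = k.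
Proof.
case: k => [|[|k]] // _; rewrite leq_eqVlt => /orP[/eqP // | ltj].
move=> le; have := leq_trans le (leq_elem_series (ltj : j <= k.+1)).
rewrite leqNgt [elem_series k.+2]elem_seriesS ltn_Pmull ?elem_series_gt0 //.
by rewrite ltn_subRL addn1 -{1}(expn1 2) ltn_exp2l.
Qed.

Lemma card_comp_series_abelem2 (gT : finGroupType) (G : {group gT}) m :
  (2.-abelem G)%g -> #|G| = 2 ^ m -> #|comp_series G| = elem_series m.
Proof.
elim: m G => [|m IHm] G abG oG.
  have -> : G = 1%G by apply/val_inj/eqP; rewrite trivg_card1 oG.
  by rewrite card_comp_series1 /elem_series big_geq.
have ntG : (G :!=: 1)%g by rewrite -cardG_gt1 oG (@leq_exp2l 2 1).
rewrite card_comp_series_rec // elem_seriesS -(card_maxns_abelem2 abG oG).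
rewrite -sum_nat_const; apply: eq_bigr => H; rewrite inE => maxH.
have sHG := maxnormal_sub maxH; apply: IHm (abelemS sHG abG) _.
have solG := abelian_sol (abelem_abelian abG).
have pr := index_maxnormal_sol_prime solG maxH.
have : (#|G : H|%g %| 2 ^ m.+1) by rewrite -oG dvdn_indexg.
rewrite Euclid_dvdX // dvdn_prime2 // andbT => /eqP idx.
apply/eqP; have := Lagrange sHG.
by rewrite idx oG expnS mulnC => /eqP; rewrite eqn_pmul2l.
Qed.

(** Equality needs [1 < m] because the groups of order 2 and 3 both have m = 1 and a single
    series. *)
Lemma card_comp_series_max (gT : finGroupType) (G : {group gT})
    (m := trunc_log 2 #|G|) :
  #|comp_series G| <= elem_series m /\
  (1 < m -> #|comp_series G| = elem_series m ->
    (2.-abelem G)%g /\ #|G| = 2 ^ m).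
Proof.
rewrite {}/m; have [n] := ubnP #|G|; elim: n G => // n IHn G /ltnSE-leGn.
have [-> | ntG] := eqVneq G 1%G.
  by rewrite card_comp_series1 cards1 trunc_log1 elem_series_gt0.
have : 0 < trunc_log 2 #|G| by rewrite trunc_log_gt0 //= cardG_gt1.
have [] := card_maxns G.
case m_def: (trunc_log 2 #|G|) => [|m] // ltM eqM _.
have IHm (H : {group gT}) (k := trunc_log 2 #|H|) :
    H \in maxns G ->
    [/\ k <= m, #|comp_series H| <= elem_series k
      & 1 < k -> #|comp_series H| = elem_series k ->
        (2.-abelem H)%g /\ #|H| = 2 ^ k].
  rewrite inE => maxH; have ltHG := maxnormal_proper maxH.
  have [] := IHn H (leq_trans (proper_card ltHG) leGn); split=> //.
  rewrite -ltnS -(ltn_exp2l _ _ (isT : 1 < 2)) -(ltn_pmul2l (isT : 0 < 2)).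
  rewrite -[X in _ < X]expnS -m_def.
  apply: leq_ltn_trans (trunc_log_ltn #|G| (isT : 1 < 2)).
  rewrite -(Lagrange (proper_sub ltHG)) mulnC leq_mul ?trunc_logP //.
  by rewrite indexg_gt1; case/andP: ltHG.
have leH H : H \in maxns G ->
    #|comp_series H| <= elem_series m ?= iff (#|comp_series H| == elem_series m).
  move=> /IHm[lem leH _]; split=> //.
  exact: leq_trans leH (leq_elem_series lem).
have := leqif_sum leH.
rewrite sum_nat_const card_comp_series_rec // => sumG.
rewrite elem_seriesS; have leM : #|maxns G| <= 2 ^ m.+1 - 1 by lia.
have leF : #|maxns G| * elem_series m <= (2 ^ m.+1 - 1) * elem_series m.
  by rewrite leq_mul2r leM orbT.
split=> [|gt1m1 eqG]; first exact: leq_trans sumG leF.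
have eqM1 : #|maxns G| = 2 ^ m.+1 - 1.
  apply/eqP; rewrite -(eqn_pmul2r (elem_series_gt0 m)) eqn_leq leF -eqG.
  by rewrite sumG.
have eqH H : H \in maxns G -> #|comp_series H| = elem_series m.
  move: eqG; rewrite -eqM1 => /eqP; rewrite sumG => /forall_inP eqH MH.
  exact/eqP/eqH.
(* It remains to refute |G| + 1 = 2 ^ (m + 2). For m = 1, the order 7 leaves one maximal normal
   subgroup instead of 3; for m > 1, the order of [G] is even because some [H] has order 2 ^ m. *)
have [|//|oG] := eqM; first by rewrite eqM1 -addn1 subnK // expn_gt0.
have [m1 | m_neq1] := eqVneq m 1.
  have oG7 : #|G| = 7 by apply: succn_inj; rewrite oG m1.
  have : #|maxns G| <= #|[set 1%G : {group gT}]|.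
    apply/subset_leq_card/subsetP => H; rewrite !inE => /maxnormal_proper ltHG.
    have : #|H| %| 7 by rewrite -oG7 cardSg ?proper_sub.
    case/(primeP (isT : prime 7)).2/orP => /eqP oH.
      by rewrite -val_eqE /= trivg_card1 oH.
    by have := proper_card ltHG; rewrite oH oG7.
  by rewrite cards1 eqM1 m1.
have /card_gt0P[H MH] : 0 < #|maxns G|.
  by rewrite eqM1 subn_gt0 -{1}(expn0 2) ltn_exp2l.
have [leHm leHF eqabH] := IHm H MH.
have gt1m : 1 < m by rewrite ltn_neqAle eq_sym m_neq1.
have tH : trunc_log 2 #|H| = m.
  by apply: eq_elem_series => //; rewrite -(eqH H MH).
rewrite tH in eqabH; have [_ oH] := eqabH gt1m (eqH H MH).
have: 2 %| #|G|.
  rewrite inE in MH; apply: dvdn_trans (cardSg (maxnormal_sub MH)).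
  by rewrite oH dvdn_exp.
have: 2 %| #|G|.+1 by rewrite oG dvdn_exp.
by rewrite !dvdn2 /= => /negbNE ->.
Qed.

Unset Implicit Arguments.

Theorem theorem4p3 (n : nat) (hn : 4 <= n)
    (gT : finGroupType) (G : {group gT}) (hG : #|G| <= n) :
  #|comp_series G| <= \prod_(1 <= i < (trunc_log 2 n).+1) (2 ^ i - 1) /\
  (#|comp_series G| = \prod_(1 <= i < (trunc_log 2 n).+1) (2 ^ i - 1) <->
     (G \isog [set: 'rV['Z_2]_(trunc_log 2 n)])%g).
Proof.
rewrite -/(elem_series _).
have leGn := leq_trunc_log 2 hG.
have gt1n : 1 < trunc_log 2 n by apply: trunc_log_max.
have [leG eqG] := card_comp_series_max G.
(* ['F_2] is ['Z_(pdiv 2)], which computes to ['Z_2], so these facts apply to the group of the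
   statement. *)
have abV : (2.-abelem [set: 'rV['F_2]_(trunc_log 2 n)])%g.
  exact: mx_Fp_abelem.
have oV : #|[set: 'rV['F_2]_(trunc_log 2 n)]| = 2 ^ trunc_log 2 n.
  by rewrite cardsT card_mx card_Fp // mul1n.
split; first exact: leq_trans leG (leq_elem_series leGn).
split=> [oCG | isoG].
  (* The count for [n] is attained by [G], so it is at most the one for [#|G|], and the two
     logarithms agree. *)
  have eq_mn : trunc_log 2 #|G| = trunc_log 2 n.
    by apply: eq_elem_series; rewrite // -oCG.
  rewrite eq_mn in eqG; have [abG oG] := eqG gt1n oCG.
  by rewrite (isog_abelem_card _ abG) abV oV oG eqxx.
apply: card_comp_series_abelem2; last by rewrite (card_isog isoG).
by rewrite (isog_abelem isoG).
Qed.
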